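(* Let $(\Omega,\mathcal{F})$ be a measurable space with a filtration $(\mathcal{F}_t)_{t\in[0,\infty)}$. If $X:\Omega\times[0,\infty)\to\mathbb{R}$ is an adapted and absolutely continuous process, then there exists a predictable process $a:\Omega\times[0,\infty)\to\mathbb{R}$ such that all paths of $a$ are locally integrable and such that \[ X(\omega,t)=\int_0^t a(\omega,s)\,ds \] for all $(\omega,t)\in\Omega\times[0,\infty)$.
   Context: $(\Omega,\mathcal{F})$ is a measurable space and $(\mathcal{F}_t)_{t\in[0,\infty)}$ is a filtration, i.e. an increasing family of sub-sigma-algebras of $\mathcal{F}$. No probability measure is involved, and no completeness or right-continuity of the filtration is assumed. $\mathcal{B}(\cdot)$ denotes Borel sigma-algebras, and integrals $ds$ are with respect to Lebesgue measure. A (real-valued) process is a mapping $X:\Omega\times[0,\infty)\to\mathbb{R}$ such that for every $t\in[0,\infty)$ the map $X(t):\omega\mapsto X(\omega,t)$ is measurable with respect to $\mathcal{F}$ and $\mathcal{B}(\mathbb{R})$. It is adapted if for every $t\in[0,\infty)$ the map $X(t)$ is measurable with respect to $\mathcal{F}_t$. The paths of $X$ are the functions $t\mapsto X(\omega,t)$, $\omega\in\Omega$. A process is continuous if all its paths are continuous. The predictable sigma-algebra $\mathcal{P}$ is the sigma-algebra on $\Omega\times[0,\infty)$ generated by all adapted and continuous processes. A process is predictable if it is measurable with respect to $\mathcal{P}$ (and $\mathcal{B}(\mathbb{R})$). A function $f:[0,\infty)\to\mathbb{R}$ is locally integrable if it is measurable with respect to $\mathcal{B}([0,\infty))$ and $\mathcal{B}(\mathbb{R})$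 and $\int_0^t|f|\,ds<\infty$ for all $t\in[0,\infty)$. A function $G:[0,\infty)\to\mathbb{R}$ is absolutely continuous if there exists a locally integrable function $f:[0,\infty)\to\mathbb{R}$ such that $G(t)=\int_0^t f\,ds$ for all $t\in[0,\infty)$ (so in particular $G(0)=0$). A process is absolutely continuous if every one of its paths is absolutely continuous in this sense; no joint measurability of the densities in $(\omega,t)$ is assumed. *)

(* Defs.v *)
From HB Require Import structures.
From mathcomp Require Import all_boot all_order all_algebra.
From mathcomp Require Import all_classical all_reals all_analysis.

Set Implicit Arguments.
Unset Strict Implicit.
Unset Printing Implicit Defensive.

Import Order.TTheory GRing.Theory Num.Theory.
Import numFieldNormedType.Exports.

Local Open Scope classical_set_scope.
Local Open Scope ring_scope.

(* Encoding of the time axis: a function on [0, oo[ (resp. Omega x [0, oo[) is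
   represented by a function on R (resp. Omega * R), and every notion below
   depends only on its values at times t >= 0.  Sigma-algebras are set systems
   satisfying [sigma_algebra] rather than instances of [measurableType]; in
   particular Omega is an arbitrary type, possibly empty, whereas
   [measurableType] would require it to be pointed. *)

Definition time (R : realType) : set R := `[0, +oo[.
Arguments time R _ : clear implicits.

(* f, restricted to D, is measurable from the sigma-algebra S on D to the Borel
   sigma-algebra of R: the sets D `&` f @^-1` B, B Borel, are all in S. *)
Definition measurable_wrt (R : realType) (T : Type) (D : set T)
    (S : set (set T)) (f : T -> R) : Prop :=
  preimage_set_system D f (measurable : set (set R)) `<=` S.

Definition is_filtration (R : realType) (Omega : Type)
    (F : set (set Omega)) (Ft : R -> set (set Omega)) : Prop :=
  [/\ forall t, time R t -> sigma_algebra [set: Omega] (Ft t),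
      forall t, time R t -> Ft t `<=` F &
      forall s t, time R s -> time R t -> s <= t -> Ft s `<=` Ft t].

Definition is_process (R : realType) (Omega : Type)
    (F : set (set Omega)) (X : Omega * R -> R) : Prop :=
  forall t, time R t -> measurable_wrt [set: Omega] F (fun w => X (w, t)).

Definition adapted (R : realType) (Omega : Type)
    (Ft : R -> set (set Omega)) (X : Omega * R -> R) : Prop :=
  forall t, time R t -> measurable_wrt [set: Omega] (Ft t) (fun w => X (w, t)).

Definition sample_path (R : realType) (Omega : Type) (X : Omega * R -> R)
    (w : Omega) : R -> R := fun t => X (w, t).

(* The subspace topology makes continuity at 0 one-sided. *)
Definition continuous_process (R : realType) (Omega : Type)
    (X : Omega * R -> R) : Prop :=
  forall w, {within time R, continuous (sample_path X w)}.

Definition predictable_sigma_algebra (R : realType) (Omega : Type)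
    (F : set (set Omega)) (Ft : R -> set (set Omega)) : set (set (Omega * R)) :=
  <<s [set: Omega] `*` time R,
      \bigcup_(Y in [set Y : Omega * R -> R |
          [/\ is_process F Y, adapted Ft Y & continuous_process Y]])
        preimage_set_system ([set: Omega] `*` time R) Y (measurable : set (set R)) >>.

Definition predictable (R : realType) (Omega : Type)
    (F : set (set Omega)) (Ft : R -> set (set Omega)) (X : Omega * R -> R) :
    Prop :=
  measurable_wrt ([set: Omega] `*` time R) (predictable_sigma_algebra F Ft) X.

(* The library's [locally_integrable] requires an open domain, hence does not
   apply to [0, oo[. *)
Definition locally_integrable_time (R : realType) (f : R -> R) : Prop :=
  measurable_fun (time R) f /\
  forall t, time R t ->
    (\int[@lebesgue_measure R]_(s in `[0%R, t]) `|f s|%:E < +oo)%E.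

(* The library's [abs_continuous] is the epsilon-delta notion on a segment;
   here G is the indefinite integral of a density, so that G 0 = 0. *)
Definition absolutely_continuous_time (R : realType) (G : R -> R) : Prop :=
  exists f : R -> R, locally_integrable_time f /\
    forall t, time R t -> G t = \int[@lebesgue_measure R]_(s in `[0, t]) f s.

Definition absolutely_continuous_process (R : realType) (Omega : Type)
    (X : Omega * R -> R) : Prop :=
  forall w, absolutely_continuous_time (sample_path X w).

(* Main.v *)
Require Import Defs.
From HB Require Import structures.
From mathcomp Require Import all_boot all_order all_algebra.
From mathcomp Require Import all_classical all_reals all_analysis.
From mathcomp Require Import measurable_realfun.

Set Implicit Arguments.
Unset Strict Implicit.
Unset Printing Implicit Defensive.

Import Order.TTheory GRing.Theory Num.Theory.
Import numFieldNormedType.Exports.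

Local Open Scope classical_set_scope.
Local Open Scope ring_scope.

(** Let f be a density of a path x of X.  By Lebesgue's differentiation theorem
    the left difference quotients

      n.+1 * (x t - x (max (t - 1/n.+1) 0))

    converge to f t for almost every t >= 0.  They only look at the past of t,
    so as functions of (w, t) they are adapted, and they are continuous in t
    since paths of X are: each of them is one of the generators of the
    predictable sigma-algebra.  Their upper limit, sent to the reals by [fine]
    so that infinite values become 0, is therefore predictable, and it is
    defined without choosing any density.  On each path it agrees almost
    everywhere with f, hence is itself a density of that path.

    The pathwise half is [backward_derivate_density].  It extends x by 0 to the
    negative half-line, as the primitive from -oo of the restriction of f:
    the extension is continuous on the whole line, it is almost everywhere
    differentiable with derivative f on [0, oo[, and it absorbs the truncation
    at 0 in the difference quotients.

    The measurability half has to cope with sigma-algebras on a possibly empty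
    type.  [measurable_wrt_seq_comp] transfers the measurability of a
    functional on the space of real sequences, which is a genuine measurable
    type, to any sequence of functions measurable for an arbitrary set system
    that is a sigma-algebra.  It is used once for the difference of two values
    of X and once for the upper limit. *)

(** * Measurable functionals of real sequences *)

(** These generate the product sigma-algebra on [nat -> R]. *)
Definition coordinate_sets (R : realType) : set (set (nat -> R)) :=
  \bigcup_n preimage_set_system setT (fun u => u n) measurable.

(** The sets of sequences whose preimage under x |-> (f n x)_n lies in S form a
    sigma-algebra, and it contains the coordinate sets, hence every set
    measurable for the product sigma-algebra. *)
Lemma measurable_wrt_seq_comp (R : realType) (T : Type) (D : set T)
    (S : set (set T)) (f : nat -> T -> R)
    (phi : g_sigma_algebraType (@coordinate_sets R) -> R) :
  sigma_algebra D S -> measurable_fun setT phi ->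
  (forall n, measurable_wrt D S (f n)) ->
  measurable_wrt D S (fun x => phi (fun n => f n x)).
Proof.
move=> sS mphi mf _ [B mB <-].
pose Phi x : nat -> R := fun n => f n x.
have sPhi : sigma_algebra setT (image_set_system D Phi S).
  exact: sigma_algebra_image.
suff sub : <<s @coordinate_sets R >> `<=` image_set_system D Phi S.
  by have := mphi measurableT B mB; rewrite setTI => /sub.
apply: smallest_sub => // _ [n _ [C mC <-]].
by rewrite setTI; apply: (mf n); exists C.
Qed.

Lemma measurable_coordinate (R : realType) n :
  measurable_fun setT
    (fun u : g_sigma_algebraType (@coordinate_sets R) => u n : R).
Proof.
move=> _ B mB; apply: sub_sigma_algebra; exists n => //.
by exists B.
Qed.

Definition real_limsup (R : realType) (u : nat -> R) : R :=
  fine (limn_esup (fun n => (u n)%:E)).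

Lemma cvg_real_limsup (R : realType) (u : nat -> R) (l : R) :
  u @ \oo --> l -> real_limsup u = l.
Proof.
move=> ul; rewrite /real_limsup.
have /cvg_limn_einf_sup[_ ->//] : (fun n => (u n)%:E) @ \oo --> l%:E.
by apply: cvg_EFin => //; exact: nearW.
Qed.

Lemma measurable_fun_real_limsup (R : realType) d (T : measurableType d)
    (D : set T) (f : nat -> T -> R) :
  (forall n, measurable_fun D (f n)) ->
  measurable_fun D (fun x => real_limsup (f ^~ x)).
Proof.
move=> mf; apply: (measurableT_comp (fine_measurable measurableT)).
apply: (@measurable_fun_limn_esup _ _ _ D (fun n x => (f n x)%:E)) => n.
exact/measurable_EFinP.
Qed.

Lemma measurable_wrt_real_limsup (R : realType) (T : Type) (D : set T)
    (S : set (set T)) (f : nat -> T -> R) :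
  sigma_algebra D S -> (forall n, measurable_wrt D S (f n)) ->
  measurable_wrt D S (fun x => real_limsup (f ^~ x)).
Proof.
move=> sS; apply: (measurable_wrt_seq_comp (phi := @real_limsup R) sS).
apply: (@measurable_fun_real_limsup _ _
  (g_sigma_algebraType (@coordinate_sets R)) _ (fun n u => u n)) => n.
exact: measurable_coordinate.
Qed.

Lemma measurable_wrt_scaled_difference (R : realType) (T : Type) (D : set T)
    (S : set (set T)) (c : R) (f g : T -> R) :
  sigma_algebra D S -> measurable_wrt D S f -> measurable_wrt D S g ->
  measurable_wrt D S (fun x => c * (f x - g x)).
Proof.
move=> sS mf mg.
(* The pair (f, g) is seen as the sequence f, g, g, ... *)
apply: (measurable_wrt_seq_comp (f := fun k => if k is 0 then f else g)
  (phi := fun u => c * (u 0 - u 1%N)) sS); last by case.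
apply: measurable_funM => //.
by apply: measurable_funB; exact: measurable_coordinate.
Qed.

(** * Left difference quotients *)

(** Truncating at 0 keeps the arguments in the time axis, so that the quotient
    depends on x only through its values at nonnegative times. *)
Definition backward_quotient (R : realType) (n : nat) (x : R -> R)
    (t : R) : R :=
  n.+1%:R * (x t - x (Num.max (t - n.+1%:R^-1) 0)).

(** Taking an upper limit, rather than a limit where there is one, avoids
    discussing the measurability of the set of convergence. *)
Definition backward_derivate (R : realType) (x : R -> R) (t : R) : R :=
  real_limsup (fun n => backward_quotient n x t).

Lemma derivable_backward_quotient (R : realType) (G : R -> R) (t : R) :
  derivable G t 1 ->
  n.+1%:R * (G t - G (t - n.+1%:R^-1)) @[n --> \oo] --> derive1 G t.
Proof.
move=> /cvg_ex[l Gl].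
have -> : derive1 G t = l.
  by rewrite derive1E; apply/cvg_lim => //; exact: Gl.
have h0 : (fun n : nat => - n.+1%:R^-1 : R) @ \oo --> (0 : R)^'.
  move=> A [e e0 eA].
  have : (fun n : nat => - n.+1%:R^-1 : R) @ \oo --> (0 : R).
    by rewrite -[X in _ --> X]oppr0; apply: cvgN; exact: cvg_harmonic.
  move/cvgrPdist_lt => /(_ e e0); apply: filterS => n ne.
  by apply: eA; [exact: ne|rewrite oppr_eq0 invr_eq0 pnatr_eq0].
have := cvg_comp _ _ h0 Gl; apply: cvg_trans.
apply: near_eq_cvg; near=> n.
rewrite /= /GRing.scale /= invrN invrK mulr1.
by rewrite mulNr -mulrN opprB (addrC _ t).
Unshelve. all: by end_near. Qed.

(** * Lebesgue differentiation of an absolutely continuous path *)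

Section extended_path.
Context (R : realType) (f : R -> R).
Hypothesis locf : locally_integrable_time f.
Notation mu := (@lebesgue_measure R).

(** Local integrability controls f on bounded intervals only, but the
    restriction vanishes at negative times, so that D need not be bounded
    below. *)
Lemma integrable_restrict_time (D : set R) (b : R) :
  measurable D -> D `<=` [set t | t <= b] ->
  mu.-integrable D (EFin \o f \_ (time R)).
Proof.
have [mf intf] := locf; move=> mD Db.
have mt : measurable (time R) by exact: measurable_itv.
rewrite -restrict_EFin; apply/integrable_restrict => //.
apply: (@integrableS _ _ _ mu `[0, Num.max b 0]%classic) => //.
- exact: measurableI.
- move=> t [/Db/= tb]; rewrite /time/= !in_itv/= andbT => -> /=.
  by rewrite le_max tb.
apply/integrableP; split.
  apply/measurable_EFinP; apply: measurable_funS mf => // t.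
  by rewrite /time/= !in_itv/= andbT => /andP[].
by apply: intf; rewrite /time/= in_itv/= andbT le_max lexx orbT.
Qed.

Lemma locally_integrable_restrict_time :
  locally_integrable [set: R] (f \_ (time R)).
Proof.
have [mf intf] := locf; split.
- by apply/(measurable_restrictT _ _).1 => //; exact: measurable_itv.
- exact: openT.
- move=> K _ cK.
  have [M [Mr KM]] := compact_bounded cK.
  have /integrableP[] // : mu.-integrable K (EFin \o f \_ (time R)).
  apply: (@integrable_restrict_time _ (M + 1)); first exact: compact_measurable.
  move=> t Kt /=; rewrite (le_trans (ler_norm _))//.
  by apply: KM => //; rewrite ltrDl.
Qed.

Definition extended_path (y : R) : R :=
  \int[mu]_(s in `]-oo, y]) (f \_ (time R)) s.

Lemma Rintegral_restrict_time (A : set R) (t : R) :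
  A `&` time R = `[0, t]%classic ->
  \int[mu]_(s in A) (f \_ (time R)) s = \int[mu]_(s in `[0, t]) f s.
Proof. by move=> AE; rewrite -Rintegral_mkcondr AE. Qed.

Lemma extended_pathE (t : R) :
  extended_path t = \int[mu]_(s in `[0, t]) f s.
Proof.
apply: Rintegral_restrict_time; apply/seteqP; split => s;
  rewrite /time/= !in_itv/= andbT; first by move=> [-> ->].
by move=> /andP[-> ->].
Qed.

Lemma extended_path_le0 (t : R) : t <= 0 -> extended_path t = 0.
Proof.
rewrite extended_pathE le_eqVlt => /predU1P[->|t0].
  by rewrite set_itv1 Rintegral_set1.
by rewrite set_itv_ge ?Rintegral_set0// bnd_simp -ltNge.
Qed.

(** Around t the extension is the integral of [f \_ (time R)] from any negative
    lower bound; such an integral is continuous inside its interval of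
    definition, and starting below 0 makes 0 an interior point. *)
Lemma continuous_extended_path : continuous extended_path.
Proof.
move=> t; pose b := `|t| + 1.
have tb : t \in `](- b), b[.
  by rewrite in_itv/= -ltr_norml /b ltrDl.
have b0 : 0 < b by rewrite ltr_wpDl.
have bb : - b < b by rewrite -subr_gt0 opprK addr_gt0.
apply: (within_continuous_continuous bb) tb.
have intf : mu.-integrable `[(- b), b] (EFin \o f \_ (time R)).
  apply: (@integrable_restrict_time _ b) => //.
  by move=> s /=; rewrite in_itv/= => /andP[].
rewrite (_ : extended_path =
  (parameterized_integral mu (- b))^~ (f \_ (time R))).
  exact: parameterized_integral_continuous (ltW bb) intf.
apply/funext => y; rewrite extended_pathE /parameterized_integral.
apply/esym/Rintegral_restrict_time.
apply/seteqP; split => s; rewrite /time/= !in_itv/= !andbT.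
  by move=> [/andP[_ ->] ->].
move=> /andP[s0 ->]; split => //; rewrite andbT (le_trans _ s0)//.
by rewrite oppr_le0 ltW.
Qed.

Lemma ae_derivable_extended_path :
  {ae mu, forall t, 0 <= t ->
    derivable extended_path t 1 /\ derive1 extended_path t = f t}.
Proof.
have intf y : mu.-integrable `]-oo, y] (EFin \o f \_ (time R)).
  exact: (@integrable_restrict_time _ y).
have := FTC1Ny intf locally_integrable_restrict_time.
apply: filterS; first exact: (ae_filter_ringOfSetsType mu).
move=> t [dG GE] t0; split => //; rewrite [LHS]GE patchE mem_set//.
by rewrite /time/= in_itv/= andbT.
Qed.

Variable (x : R -> R).
Hypothesis xE : forall t, time R t -> x t = \int[mu]_(s in `[0, t]) f s.

(** When t - 1/n.+1 is negative, the truncated quotient uses x 0 = 0, which is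
    also the value of the extension at t - 1/n.+1. *)
Lemma backward_quotient_extended_path n (t : R) : 0 <= t ->
  backward_quotient n x t =
  n.+1%:R * (extended_path t - extended_path (t - n.+1%:R^-1)).
Proof.
move=> t0.
have xG s : 0 <= s -> x s = extended_path s.
  by move=> s0; rewrite extended_pathE xE// /time/= in_itv/= andbT.
rewrite /backward_quotient !xG ?le_max ?lexx ?orbT//; congr (_ * (_ - _)).
case: (leP (t - n.+1%:R^-1) 0) => // h0.
by rewrite !extended_path_le0.
Qed.

Lemma within_continuous_backward_quotient n :
  {within time R, continuous (backward_quotient n x)}.
Proof.
apply: (@subspace_eq_continuous _ _ _ (fun t => n.+1%:R *
   (extended_path t - extended_path (t - n.+1%:R^-1)))).
  move=> t; rewrite inE /time/= in_itv/= andbT => t0.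
  exact/esym/backward_quotient_extended_path.
apply: continuous_subspaceT => t; apply: cvgM; first exact: cvg_cst.
apply: cvgB; first exact: continuous_extended_path.
apply: (@cvg_comp _ _ _ (fun t => t - n.+1%:R^-1));
  last exact: continuous_extended_path.
by apply: cvgB; [exact: cvg_id|exact: cvg_cst].
Qed.

Lemma measurable_backward_derivate :
  measurable_fun (time R) (backward_derivate x).
Proof.
apply: measurable_fun_real_limsup => n.
apply: subspace_continuous_measurable_fun; first exact: measurable_itv.
exact: within_continuous_backward_quotient.
Qed.

Lemma ae_eq_backward_derivate :
  {ae mu, forall t, 0 <= t -> backward_derivate x t = f t}.
Proof.
have := ae_derivable_extended_path.
apply: filterS; first exact: (ae_filter_ringOfSetsType mu).
move=> t + t0 => /(_ t0)[dG <-].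
apply: cvg_real_limsup.
under eq_fun do rewrite backward_quotient_extended_path//.
exact: derivable_backward_quotient.
Qed.

End extended_path.

(** The density obtained this way depends on x alone, not on the density that
    witnesses its absolute continuity; this is what makes it predictable when x
    runs through the paths of a process. *)
Lemma backward_derivate_density (R : realType) (x : R -> R) :
  absolutely_continuous_time x ->
  locally_integrable_time (backward_derivate x) /\
  forall t, 0 <= t ->
    x t = \int[@lebesgue_measure R]_(s in `[0, t]) backward_derivate x s.
Proof.
move=> [f [locf xE]].
have mbd := measurable_backward_derivate locf xE.
have aebd := ae_eq_backward_derivate locf xE.
have restr (g : R -> R) (t : R) :
    measurable_fun (time R) g -> measurable_fun `[0, t] g.
  move=> mg; apply: measurable_funS mg; first exact: measurable_itv.
  by move=> s; rewrite /time/= !in_itv/= andbT => /andP[].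
have aeE (t : R) : ae_eq (@lebesgue_measure R) `[0, t]%classic
    (backward_derivate x) f.
  move: aebd; apply: filterS.
    exact: (ae_filter_ringOfSetsType lebesgue_measure).
  by move=> s bdE /=; rewrite in_itv/= => /andP[/bdE].
have [mf intf] := locf; split.
  split => // t t0; rewrite (_ : (\int[_]_(_ in _) _)%E =
    (\int[@lebesgue_measure R]_(s in `[0%R, t]) `|f s|%:E)%E);
    first exact: intf.
  apply: ae_eq_integral => //.
  - by apply/measurable_EFinP/measurableT_comp => //; exact: restr.
  - by apply/measurable_EFinP/measurableT_comp => //; exact: restr.
  - exact: (ae_eq_comp (fun r : R => `|r|%:E) (aeE t)).
move=> t t0; rewrite xE; last by rewrite /time/= in_itv/= andbT.
congr fine; apply: ae_eq_integral => //.
- by apply/measurable_EFinP; exact: restr.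
- by apply/measurable_EFinP; exact: restr.
- exact/(ae_eq_comp EFin)/ae_eq_sym.
Qed.

(** * Predictable density *)

Theorem theorem1 (R : realType) (Omega : Type) (F : set (set Omega))
    (sigmaF : sigma_algebra [set: Omega] F)
    (Ft : R -> set (set Omega)) (filtF : is_filtration F Ft)
    (X : Omega * R -> R) (procX : is_process F X) (adX : adapted Ft X)
    (acX : absolutely_continuous_process X) :
  exists a : Omega * R -> R,
    [/\ is_process F a,
        predictable F Ft a,
        forall w : Omega, locally_integrable_time (sample_path a w) &
        forall (w : Omega) (t : R), 0 <= t ->
          X (w, t) = \int[@lebesgue_measure R]_(s in `[0, t]) a (w, s)].
Proof.
have [sFt FtF FtS] := filtF.
pose Y n (p : Omega * R) := backward_quotient n (sample_path X p.1) p.2.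
have adY n : adapted Ft (Y n).
  move=> t t0; set s := Num.max (t - n.+1%:R^-1) 0.
  have s0 : time R s by rewrite /time/= in_itv/= andbT le_max lexx orbT.
  have st : s <= t.
    move: t0; rewrite /time/= in_itv/= andbT ge_max => ->.
    by rewrite andbT lerBlDr lerDl.
  apply: (measurable_wrt_scaled_difference (f := fun w => X (w, t))
    (g := fun w => X (w, s))); [exact: sFt|exact: adX|].
  exact: subset_trans (adX _ s0) (FtS _ _ s0 t0 st).
have procY n : is_process F (Y n).
  by move=> t t0; apply: subset_trans (FtF _ t0); exact: adY.
have contY n : continuous_process (Y n).
  move=> w; have [f [locf xE]] := acX w.
  rewrite (_ : sample_path (Y n) w = backward_quotient n (sample_path X w))//.
  exact: within_continuous_backward_quotient locf _ xE _.
exists (fun p => backward_derivate (sample_path X p.1) p.2); split.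
- move=> t t0; apply: (measurable_wrt_real_limsup
    (f := fun n w => Y n (w, t)) sigmaF) => n.
  exact: (procY n t t0).
- apply: (measurable_wrt_real_limsup (f := Y)).
    exact: smallest_sigma_algebra.
  by move=> n A AY; apply: sub_sigma_algebra; exists (Y n).
- by move=> w; have [] := backward_derivate_density (acX w).
- by move=> w; have [] := backward_derivate_density (acX w).
Qed.
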